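(* Let $Q$ be a smooth manifold, $H\in C^\infty(T^*Q)$, and let $\Psi:T^*Q\to T^*Q$ be a fouling map for $H$. Then for every $l\in\mathbb{N}$ the trace of $L_\Psi^l=L_\Psi\circ\cdots\circ L_\Psi$ ($l$ factors) is a constant of motion of the Hamiltonian vector field $X_H$, i.e. $X_H(\operatorname{Tr} L_\Psi^l)=0$.
   Context: $\omega_Q$ is the canonical symplectic form on $T^*Q$, locally $\omega_Q=dq^i\wedge dp_i$; $\pi_Q:T^*Q\to Q$ is the projection. For $H\in C^\infty(T^*Q)$ the Hamiltonian vector field $X_H$ is defined by $i_{X_H}\omega_Q=dH$. A bundle map over the identity is a smooth map $\Psi:T^*Q\to T^*Q$ with $\pi_Q\circ\Psi=\pi_Q$ (not necessarily fiberwise linear, nor invertible). Put $\omega_\Psi=\Psi^*\omega_Q$. Such a $\Psi$ is a fouling map for $H$ if $\mathcal{L}_{X_H}\omega_\Psi=d(i_{X_H}\omega_\Psi)=0$. The $(1,1)$-tensor field $L_\Psi:T^*(T^*Q)\to T^*(T^*Q)$ is the vector bundle endomorphism $L_\Psi=\flat_{\omega_\Psi}\circ\#_{\omega_Q}$, where $\flat_{\omega_\Psi}(X)=i_X\omega_\Psi$ for $X\in T(T^*Q)$ and $\#_{\omega_Q}:T^*(T^*Q)\to T(T^*Q)$ is characterized by $i_{\#_{\omega_Q}(\alpha)}\omega_Q=\alpha$. *)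

(* Defs.v *)
From mathcomp Require Import all_boot all_order all_algebra.
From mathcomp Require Import all_classical all_reals all_analysis.

Set Implicit Arguments.
Unset Strict Implicit.
Unset Printing Implicit Defensive.

Import Order.TTheory GRing.Theory Num.Theory.
Import numFieldNormedType.Exports.

Local Open Scope classical_set_scope.
Local Open Scope ring_scope.

Definition unit_row (R : realType) (m : nat) (i : 'I_m) : 'rV[R]_m :=
  delta_mx 0 i.

Definition partials (R : realType) (m : nat) (W : normedModType R)
    (s : seq 'I_m) (f : 'rV[R]_m -> W) : 'rV[R]_m -> W :=
  foldr (fun i g => 'D_(unit_row R i) g) f s.

(* C^oo: the iterated partial derivatives of every order are (Frechet)
   differentiable, hence also continuous, at every point of [U]. *)
Definition smooth_on (R : realType) (m : nat) (W : normedModType R)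
    (U : set 'rV[R]_m) (f : 'rV[R]_m -> W) : Prop :=
  forall (s : seq 'I_m) (z : 'rV[R]_m), U z -> differentiable (partials s f) z.

(* [chart_inv] is only meaningful on the image [chart_coord @` chart_dom]. *)
Record chart (R : realType) (m : nat) (M : Type) := Chart {
  chart_dom : set M;
  chart_coord : M -> 'rV[R]_m;
  chart_inv : 'rV[R]_m -> M }.

(* [chart_at x] is a preferred chart around [x], used to represent the tangent
   and cotangent spaces at [x] by coordinate rows. No coherence between the
   choices at different points is assumed. *)
Record atlas (R : realType) (m : nat) (M : Type) := Atlas {
  charts : set (chart R m M);
  chart_at : M -> chart R m M }.

Record smooth_manifold (R : realType) (m : nat) (M : topologicalType)
    (A : atlas R m M) : Prop := SmoothManifold {
  manifold_hausdorff : hausdorff_space M;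
  manifold_second_countable : @second_countable M;
  chart_atP : forall x : M,
    charts A (chart_at A x) /\ chart_dom (chart_at A x) x;
  open_dom : forall c, charts A c -> open (chart_dom c);
  open_image : forall c, charts A c -> open (chart_coord c @` chart_dom c);
  continuous_coord : forall c, charts A c ->
    forall x, chart_dom c x -> {for x, continuous (chart_coord c)};
  continuous_inv_coord : forall c, charts A c ->
    forall z, (chart_coord c @` chart_dom c) z ->
    {for z, continuous (chart_inv c)};
  coordK : forall c, charts A c ->
    forall x, chart_dom c x -> chart_inv c (chart_coord c x) = x;
  smooth_transition : forall c d, charts A c -> charts A d ->
    smooth_on (chart_coord c @` (chart_dom c `&` chart_dom d))
      (chart_coord d \o chart_inv c) }.

Definition model_atlas (R : realType) (m : nat) : atlas R m 'rV[R]_m :=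
  let c := Chart setT id id in Atlas [set c] (fun=> c).

Definition smooth_fun (R : realType) (m : nat) (M : Type) (A : atlas R m M)
    (f : M -> R) : Prop :=
  forall c, charts A c ->
    smooth_on (chart_coord c @` chart_dom c) (f \o chart_inv c).

(* The openness clause is the continuity of [f] for the topologies induced by
   the atlases; it makes the second clause a condition on an open set. *)
Definition smooth_map (R : realType) (m k : nat) (M N : Type)
    (A : atlas R m M) (B : atlas R k N) (f : M -> N) : Prop :=
  forall c d, charts A c -> charts B d ->
    let U := chart_coord c @` (chart_dom c `&` f @^-1` chart_dom d) in
    open U /\ smooth_on U (chart_coord d \o f \o chart_inv c).

(* A tangent vector at [x] is given by its components in the coordinate frame
   of [chart_at A x], a covector by its components in the dual coframe. *)
Definition tangent (R : realType) (m : nat) (M : Type) (A : atlas R m M)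
  (x : M) : Type := 'rV[R]_m.

Definition cotangent (R : realType) (m : nat) (M : Type) (A : atlas R m M)
  (x : M) : Type := 'rV[R]_m.

Definition pairing (R : realType) (m : nat) (a v : 'rV[R]_m) : R :=
  \sum_(i < m) a 0 i * v 0 i.

Definition tangent_map (R : realType) (m k : nat) (M N : Type)
    (A : atlas R m M) (B : atlas R k N) (f : M -> N) (x : M) :
    tangent A x -> tangent B (f x) :=
  'd (chart_coord (chart_at B (f x)) \o f \o chart_inv (chart_at A x))
     (chart_coord (chart_at A x) x).
Arguments tangent_map {R m k M N} A B f x v.

Definition cotangent_map (R : realType) (m k : nat) (M N : Type)
    (A : atlas R m M) (B : atlas R k N) (f : M -> N) (x : M)
    (a : cotangent B (f x)) : cotangent A x :=
  \row_(j < m) pairing a (tangent_map A B f x (unit_row R j)).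
Arguments cotangent_map {R m k M N} A B f x a.

Definition vector_field (R : realType) (m : nat) (M : Type)
  (A : atlas R m M) : Type := forall x : M, tangent A x.

Definition form1 (R : realType) (m : nat) (M : Type)
  (A : atlas R m M) : Type := forall x : M, cotangent A x.

Definition form2 (R : realType) (m : nat) (M : Type)
  (A : atlas R m M) : Type := forall x : M, tangent A x -> tangent A x -> R.

Definition pullback1 (R : realType) (m k : nat) (M N : Type)
    (A : atlas R m M) (B : atlas R k N) (f : M -> N) (b : form1 B) : form1 A :=
  fun x => cotangent_map A B f x (b (f x)).
Arguments pullback1 {R m k M N} A B f b x.

Definition pullback2 (R : realType) (m k : nat) (M N : Type)
    (A : atlas R m M) (B : atlas R k N) (f : M -> N) (w : form2 B) : form2 A :=
  fun x u v => w (f x) (tangent_map A B f x u) (tangent_map A B f x v).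
Arguments pullback2 {R m k M N} A B f w x u v.

Definition differential (R : realType) (m : nat) (M : Type) (A : atlas R m M)
    (f : M -> R) : form1 A :=
  fun x => \row_(j < m)
    'd (f \o chart_inv (chart_at A x)) (chart_coord (chart_at A x) x)
      (unit_row R j).
Arguments differential {R m M} A f x.

Definition lie_derivative_fun (R : realType) (m : nat) (M : Type)
    (A : atlas R m M) (X : vector_field A) (f : M -> R) : M -> R :=
  fun x => pairing (differential A f x) (X x).

(* With [b'] the local expression of [b] in the preferred chart at [x]:
   (db)_x(u, v) = D_u (b'(v)) - D_v (b'(u)), for u, v constant in that chart. *)
Definition ext_derivative (R : realType) (m : nat) (M : Type)
    (A : atlas R m M) (b : form1 A) : form2 A :=
  fun x u v =>
    let c := chart_at A x in
    let b' := pullback1 (model_atlas R m) A (chart_inv c) b in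
    'D_u (fun z => pairing (b' z) v) (chart_coord c x)
    - 'D_v (fun z => pairing (b' z) u) (chart_coord c x).
Arguments ext_derivative {R m M A} b x u v.

(* i_X w at a point, as a covector; as a map of X this is flat_w. *)
Definition flat (R : realType) (m : nat) (M : Type) (A : atlas R m M)
    (w : form2 A) (x : M) (X : tangent A x) : cotangent A x :=
  \row_(j < m) w x X (unit_row R j).
Arguments flat {R m M A} w x X.

(* The vector X with i_X w = a; unique when [w] is nondegenerate at [x]. *)
Definition sharp (R : realType) (m : nat) (M : Type) (A : atlas R m M)
    (w : form2 A) (x : M) (a : cotangent A x) : tangent A x :=
  xget (0 : 'rV[R]_m) [set X : 'rV[R]_m | flat w x X = a].
Arguments sharp {R m M A} w x a.

Definition interior_product (R : realType) (m : nat) (M : Type)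
    (A : atlas R m M) (X : vector_field A) (w : form2 A) : form1 A :=
  fun x => flat w x (X x).
Arguments interior_product {R m M A} X w x.

Definition cotangent_bundle (R : realType) (n : nat) (Q : Type)
  (A : atlas R n Q) : Type := {q : Q & cotangent A q}.

Definition bundle_proj (R : realType) (n : nat) (Q : Type) (A : atlas R n Q)
  (x : cotangent_bundle A) : Q := projT1 x.

(* Natural coordinates (q^i, p_i) induced on T*Q by a chart [c] of Q: the p_i
   are the components of the covector in the coframe dq^i of [c]. *)
Definition cotangent_chart (R : realType) (n : nat) (Q : Type)
    (A : atlas R n Q) (c : chart R n Q) :
    chart R (n + n) (cotangent_bundle A) :=
  Chart
    [set x | chart_dom c (bundle_proj x)]
    (fun x : cotangent_bundle A =>
       row_mx (chart_coord c (projT1 x))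
         (cotangent_map (model_atlas R n) A (chart_inv c)
            (chart_coord c (projT1 x)) (projT2 x)))
    (fun z : 'rV[R]_(n + n) =>
       let q := chart_inv c (lsubmx z) in
       existT (cotangent A) q
         (cotangent_map A (model_atlas R n) (chart_coord c) q (rsubmx z))).

Definition cotangent_atlas (R : realType) (n : nat) (Q : Type)
    (A : atlas R n Q) : atlas R (n + n) (cotangent_bundle A) :=
  Atlas [set cotangent_chart A c | c in charts A]
    (fun x => cotangent_chart A (chart_at A (bundle_proj x))).

Definition tautological_form (R : realType) (n : nat) (Q : Type)
    (A : atlas R n Q) : form1 (cotangent_atlas A) :=
  fun x => cotangent_map (cotangent_atlas A) A (@bundle_proj R n Q A) x
    (projT2 x).
Arguments tautological_form {R n Q} A x.

(* omega_Q = - d theta, i.e. dq^i /\ dp_i for theta = p_i dq^i. *)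
Definition canonical_symplectic_form (R : realType) (n : nat) (Q : Type)
    (A : atlas R n Q) : form2 (cotangent_atlas A) :=
  fun x u v => - ext_derivative (tautological_form A) x u v.
Arguments canonical_symplectic_form {R n Q} A x u v.

Definition hamiltonian_vector_field (R : realType) (n : nat) (Q : Type)
    (A : atlas R n Q) (H : cotangent_bundle A -> R) :
    vector_field (cotangent_atlas A) :=
  fun x => sharp (canonical_symplectic_form A) x
    (differential (cotangent_atlas A) H x).

Definition bundle_map_over_id (R : realType) (n : nat) (Q : Type)
    (A : atlas R n Q) (Psi : cotangent_bundle A -> cotangent_bundle A) : Prop :=
  smooth_map (cotangent_atlas A) (cotangent_atlas A) Psi /\
  forall x, bundle_proj (Psi x) = bundle_proj x.

Definition omega_Psi (R : realType) (n : nat) (Q : Type)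
    (A : atlas R n Q) (Psi : cotangent_bundle A -> cotangent_bundle A) :
    form2 (cotangent_atlas A) :=
  pullback2 (cotangent_atlas A) (cotangent_atlas A) Psi
    (canonical_symplectic_form A).

(* The condition is L_X omega_Psi = d (i_X omega_Psi) = 0 for X = X_H; the first
   equality is Cartan's formula for the closed form omega_Psi. *)
Definition fouling_map (R : realType) (n : nat) (Q : Type) (A : atlas R n Q)
    (H : cotangent_bundle A -> R)
    (Psi : cotangent_bundle A -> cotangent_bundle A) : Prop :=
  bundle_map_over_id Psi /\
  forall x u v,
    ext_derivative
      (interior_product (hamiltonian_vector_field H) (omega_Psi Psi))
      x u v = 0.

Definition L_Psi (R : realType) (n : nat) (Q : Type) (A : atlas R n Q)
    (Psi : cotangent_bundle A -> cotangent_bundle A) (x : cotangent_bundle A)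
    (a : cotangent (cotangent_atlas A) x) : cotangent (cotangent_atlas A) x :=
  flat (omega_Psi Psi) x (sharp (canonical_symplectic_form A) x a).
Arguments L_Psi {R n Q A} Psi x a.

(* Trace of an endomorphism of a cotangent space, read in its coordinate
   coframe. *)
Definition cotangent_trace (R : realType) (m : nat) (M : Type)
    (A : atlas R m M) (x : M) (L : cotangent A x -> cotangent A x) : R :=
  \tr (lin1_mx (L : 'rV[R]_m -> 'rV[R]_m)).

(* Main.v *)
(* In canonical coordinates [(q, p)] let [J] be the matrix of [omega_Q] and [D]
   the Jacobian of [Psi]. Then [omega_Psi] has matrix [W = D J D^T] and [L_Psi]
   has matrix [M = J^-1 W] (row vector convention). Since [X_H] is Hamiltonian,
   its linearisation is [S J^-1] with [S] the symmetric Hessian of [H]. As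
   [omega_Psi] is closed, the fouling condition expands to
   [D_X W = W J^-1 S - S J^-1 W], i.e. to the Lax equation
   [D_X M = [M, J^-1 S]]; hence all the traces of powers of [M] are constant
   along [X_H].

   The tangent space at each point is read in its own preferred chart, so the
   argument also needs that the cotangent lift of a change of chart preserves
   [p_i dq^i], hence has a symplectic Jacobian. *)

Require Import Defs.
From mathcomp Require Import all_boot all_order all_algebra.
From mathcomp Require Import all_classical all_reals all_analysis.
From mathcomp Require Import ring lra.

Set Implicit Arguments.
Unset Strict Implicit.
Unset Printing Implicit Defensive.

Import Order.TTheory GRing.Theory Num.Theory.
Import numFieldNormedType.Exports.

Local Open Scope classical_set_scope.
Local Open Scope ring_scope.

(** * Symmetry of second derivatives *)

(** Near [a] both functions have the same remainder, so ['d f a] also satisfies the defining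
    expansion of [g], and [diff_unique] applies. It is needed throughout because chart expressions
    agree only on the image of an overlap. *)
Lemma near_eq_is_diff (R : realType) (V W : normedModType R) (f g df : V -> W)
    (a : V) : {near a, f =1 g} -> is_diff a f df -> is_diff a g df.
Proof.
move=> fg [Df Ef].
have gdiff : continuous ('d f a) /\
    g \o shift a = cst (g a) + 'd f a +o_ 0 id.
  split; first exact: diff_continuous.
  apply/eqaddoP => e e0.
  have /eqaddoP/(_ e e0) := diff_locally Df.
  have fga := nbhs_singleton fg.
  have fg0 : \forall h \near (0 : V), f (h + a) = g (h + a).
    by have := fg; rewrite (near_shift 0) subr0.
  apply: filterS2 fg0 => h fgh.
  have -> : (g \o shift a - (cst (g a) + 'd f a)) h =
     (f \o shift a - (cst (f a) + 'd f a)) h; last by [].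
  by rewrite !fctE /= fgh fga.
have Eg := diff_unique gdiff.1 gdiff.2.
apply: DiffDef; last by rewrite Eg Ef.
by apply/diff_locallyP; rewrite Eg.
Qed.

Lemma near_eq_differentiable (R : realType) (V W : normedModType R)
    (f g : V -> W) (a : V) :
  {near a, f =1 g} -> differentiable f a -> differentiable g a.
Proof.
by move=> fg /differentiableP/(near_eq_is_diff fg) H; exact: ex_diff.
Qed.

Lemma near_eq_diff (R : realType) (V W : normedModType R) (f g : V -> W)
    (a : V) : {near a, f =1 g} -> differentiable f a ->
  'd f a = 'd g a :> (V -> W).
Proof.
by move=> fg /differentiableP/(near_eq_is_diff fg) H; rewrite [RHS]diff_val.
Qed.

Section Young.
Variables (R : realType) (V : normedModType R) (f : V -> R) (z : V).

Let second_difference u v t :=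
  f (z + t *: u + t *: v) - f (z + t *: u) - f (z + t *: v) + f z.

(** The mean value theorem in direction [u] turns the second difference into [t] times the increment
    of [g = 'D_u f] between [z + xi *: u] and [z + xi *: u + t *: v]. The first-order expansion of
    [g] at [z] evaluates that increment as [t * 'D_v g z] up to two small errors. *)
Lemma second_difference_le (u v : V) (e : R) :
  (\forall y \near z, differentiable f y) ->
  differentiable ('D_u f) z -> 0 < e ->
  \forall t \near (0 : R), 0 < t ->
    `|second_difference u v t - t ^+ 2 * 'D_v ('D_u f) z| <= e * t ^+ 2.
Proof.
move=> fz gz e0; set g := 'D_u f in gz *.
pose C := `|u| + `|v|.
have C0 : 0 <= C by rewrite addr_ge0.
(* Each of the two expansion errors is at most [e' * (t * C)], so together they stay below [e * t].
   The [+ 1] keeps the denominator positive when [u] and [v] vanish. *)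
pose e' := e / (2 * (C + 1)).
have e'0 : 0 < e' by rewrite divr_gt0// mulr_gt0// ltr_wpDl.
have e'C : 2 * (e' * C) <= e.
  have : e' * (2 * (C + 1)) = e by rewrite divfK// gt_eqF// mulr_gt0// ltr_wpDl.
  by move: e'0; move: e' => k k0; nra.
have /nbhs_ballP[r /= r0 fr] : \forall y \near z, differentiable f y by [].
have /eqaddoP/(_ e' e'0)/nbhs_ballP[s /= s0 gs] := diff_locally gz.
pose q := Num.min r s.
have q0 : 0 < q by rewrite lt_min r0.
have small (a b t : R) : 0 < t -> 0 <= a <= t -> 0 <= b <= t ->
    `|a *: u + b *: v| <= t * C.
  move=> t0 /andP[a0 at_] /andP[b0 bt].
  rewrite (le_trans (ler_normD _ _))// !normrZ !ger0_norm// mulrDr.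
  by rewrite lerD// ler_wpM2r.
near=> t => t0.
have tq : t * C < q.
  have tC : t * (C + 1) < q.
    rewrite -ltr_pdivlMr ?ltr_wpDl// (le_lt_trans (ler_norm t))//; near: t.
    apply/nbhs_ballP; exists (q / (C + 1)).
      by rewrite /= divr_gt0// ltr_wpDl.
    by move=> x; rewrite -ball_normE /= sub0r normrN.
  by apply: le_lt_trans tC; rewrite ler_wpM2l ?(ltW t0)// lerDl.
have gapprox a b : 0 <= a <= t -> 0 <= b <= t ->
    `|g (z + (a *: u + b *: v)) - (g z + 'd g z (a *: u + b *: v))|
      <= e' * (t * C).
  move=> a0 b0; have abt := small _ _ _ t0 a0 b0.
  have /= := gs (a *: u + b *: v).
  rewrite -ball_normE /= sub0r normrN (le_lt_trans abt)//; last first.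
    by rewrite (lt_le_trans tq)// ge_min lexx orbT.
  rewrite !fctE /= [_ + z]addrC => /(_ isT)/le_trans; apply.
  by rewrite ler_wpM2l// ltW.
have fdiff a b : 0 <= a <= t -> 0 <= b <= t ->
    differentiable f (z + (a *: u + b *: v)).
  move=> a0 b0; apply: fr; rewrite -ball_normE /= opprD addNKr normrN.
  rewrite (le_lt_trans (small _ _ _ t0 a0 b0))// (lt_le_trans tq)//.
  by rewrite ge_min lexx.
(* The vanishing term [0 *: v] is kept so that [line] and [gapprox] serve both halves, with [b = t]
   and [b = 0]. *)
pose phi (a : R) := f (z + (a *: u + t *: v)) - f (z + (a *: u + 0 *: v)).
have line b (a : R) : 0 <= a <= t -> 0 <= b <= t ->
    is_derive a 1 (fun a => f (z + (a *: u + b *: v)))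
      (g (z + (a *: u + b *: v))).
  move=> a0t b0t.
  have fD : is_derive (z + (a *: u + b *: v)) u f (g (z + (a *: u + b *: v))).
    by apply: DeriveDef => //; apply: diff_derivable; exact: fdiff.
  have E : (fun h : R => f (z + ((h *: 1 + a) *: u + b *: v))) =
     fun h => f (h *: u + (z + (a *: u + b *: v))).
    apply/funext => h; congr f.
    by rewrite [_ *: 1]mulr1 scalerDl !addrA [z + _]addrC.
  apply: DeriveDef.
    apply/derivable1P; rewrite E.
    by apply: (derivable1P f (z + (a *: u + b *: v)) u).1; case: fD.
  rewrite /g /derive; apply: (f_equal (fun k : R -> R => lim (k @ 0^'))).
  apply/funext => h /=.
  congr (_ *: (_ - _)); exact: (congr1 (fun k => k h) E).
have tt : 0 <= t <= t by rewrite ltW//=.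
have t00 : (0 : R) <= 0 <= t by rewrite lexx ltW.
have phiD a : 0 <= a <= t ->
    is_derive a 1 phi
      (g (z + (a *: u + t *: v)) - g (z + (a *: u + 0 *: v))).
  by move=> a0t; apply: is_deriveB; exact: line.
have [|||xi xit Exi] := @MVT_segment R phi
    (fun a => g (z + (a *: u + t *: v)) - g (z + (a *: u + 0 *: v))) 0 t.
- exact: ltW.
- by move=> x /[!in_itv]/= /andP[x0 xt]; apply: phiD; rewrite !ltW.
- apply: derivable_within_continuous => x /[!in_itv]/= x0.
  by apply: ex_derive; exact: phiD.
have {}xit : 0 <= xi <= t by rewrite in_itv in xit.
have -> : second_difference u v t = phi t - phi 0.
  by rewrite /phi /second_difference !scale0r !addr0 !add0r !addrA; ring.
rewrite Exi subr0 deriveE//.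
have dgE a b : 'd g z (a *: u + b *: v) = a * 'd g z u + b * 'd g z v.
  by rewrite linearD !linearZ.
move: (gapprox _ _ xit tt) (gapprox _ _ xit t00); rewrite !dgE.
move: (g (_ + _)) (g (_ + _)) (g z) ('d g z u) ('d g z v) => G2 G1 G0 du dv.
rewrite !ler_norml => /andP[H1 H1'] /andP[H2 H2'].
have -> : (G1 - G2) * t - t ^+ 2 * dv = t * (G1 - G2 - t * dv) by ring.
have bound : -(e * t) <= G1 - G2 - t * dv <= e * t.
  have := ler_wpM2r (ltW t0) e'C.
  have -> : 2 * (e' * C) * t = 2 * (e' * (t * C)) by ring.
  move: H1 H1' H2 H2'; rewrite mul0r.
  move: (e' * (t * C)) (e * t) (xi * du) (t * dv) => k et xdu tdv.
  by move=> H1 H1' H2 H2' kt; apply/andP; split; lra.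
have -> : e * t ^+ 2 = t * (e * t) by ring.
by rewrite -mulrN !ler_wpM2l ?(ltW t0)//; case/andP: bound.
Unshelve. all: by end_near. Qed.

(* Both iterated derivatives are the limit of the second difference quotient,
   which is symmetric in [u] and [v]. *)
Lemma derive_comm (u v : V) : (\forall y \near z, differentiable f y) ->
  differentiable ('D_u f) z -> differentiable ('D_v f) z ->
  'D_v ('D_u f) z = 'D_u ('D_v f) z.
Proof.
move=> fz gu gv.
apply/eqP; rewrite -subr_eq0 -normr_eq0 eq_le normr_ge0 andbT.
apply/ler_addgt0Pl => e e0; rewrite addr0.
have e2 : 0 < e / 2 by rewrite divr_gt0.
have := second_difference_le v fz gu e2.
have := second_difference_le u fz gv e2.
move: ('D_v ('D_u f) z) ('D_u ('D_v f) z) => a b Hv Hu.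
have [t [t0 Ht]] : exists t : R, 0 < t /\
   (0 < t -> `|second_difference u v t - t ^+ 2 * a| <= e / 2 * t ^+ 2) /\
   (0 < t -> `|second_difference v u t - t ^+ 2 * b| <= e / 2 * t ^+ 2).
  have /nbhs_ballP[r /= r0 H] : \forall t \near (0 : R),
   (0 < t -> `|second_difference u v t - t ^+ 2 * a| <= e / 2 * t ^+ 2) /\
   (0 < t -> `|second_difference v u t - t ^+ 2 * b| <= e / 2 * t ^+ 2).
    by move: Hu Hv; apply: filterS2 => t Hu Hv; exact: conj.
  exists (r / 2); split; first by rewrite divr_gt0.
  apply: H; rewrite -ball_normE /= sub0r normrN gtr0_norm ?divr_gt0//.
  by rewrite ltr_pdivrMr// ltr_pMr// ltr1n.
have [/(_ t0) + /(_ t0)] := Ht.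
have -> : second_difference v u t = second_difference u v t.
  by rewrite /second_difference [z + t *: v + _]addrAC; ring.
have t20 : 0 < t ^+ 2 by rewrite exprn_gt0.
move: (t ^+ 2) t20 => T T0 Hu' Hv'; rewrite -(ler_pM2l T0).
have -> : T * `|a - b| = `|T * a - T * b| by rewrite -mulrBr normrM gtr0_norm.
move: Hu' Hv'; have -> : e / 2 * T = T * e / 2 by rewrite mulrAC [e * T]mulrC.
move: (second_difference u v t) (T * a) (T * b) => D Ta Tb.
rewrite !ler_norml => /andP[A1 A2] /andP[B1 B2].
by apply/andP; split; lra.
Qed.

End Young.

(** * Differentiation of matrix-valued functions *)

Lemma is_diff_bigsum (R : realType) (V W : normedModType R) (I : Type)
    (r : seq I) (f df : I -> V -> W) (x : V) :
  (forall i, is_diff x (f i) (df i)) ->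
  is_diff x (fun y => \sum_(i <- r) f i y) (fun v => \sum_(i <- r) df i v).
Proof.
move=> fD; elim: r => [|i r IHr].
  rewrite (_ : (fun y => _) = cst 0); last first.
    by apply/funext => y; rewrite big_nil.
  apply: (is_diff_eq (is_diff_cst 0 x)).
  by apply/funext => y; rewrite big_nil.
rewrite (_ : (fun y => _) = f i + (fun y => \sum_(i <- r) f i y)); last first.
  by apply/funext => y; rewrite big_cons.
apply: (is_diff_eq (is_diffD (fD i) IHr)).
by apply/funext => y; rewrite big_cons.
Qed.

(** The derivative is an explicit matrix-valued function, and the condition is entrywise: the
    product rule for matrices then reduces to the scalar one. *)
Definition mx_is_diff (R : realType) (V : normedModType R) (p q : nat) (z : V)
    (M dM : V -> 'M[R]_(p, q)) : Prop :=
  forall i j, is_diff z (fun y => M y i j) (fun v => dM v i j).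

Section MatrixDerivative.
Variables (R : realType) (V : normedModType R) (z : V).

Lemma mx_is_diff_near p q (M N dM : V -> 'M[R]_(p, q)) :
  {near z, M =1 N} -> mx_is_diff z M dM -> mx_is_diff z N dM.
Proof.
move=> MN MD i j; apply: near_eq_is_diff (MD i j).
by apply: filterS MN => y /= ->.
Qed.

Lemma mx_is_diff_cst p q (C : 'M[R]_(p, q)) :
  mx_is_diff z (fun=> C) (fun=> 0).
Proof.
by move=> i j; apply: is_diff_eq; apply/funext => v; rewrite mxE.
Qed.

Lemma mx_is_diff_tr p q (M dM : V -> 'M[R]_(p, q)) :
  mx_is_diff z M dM -> mx_is_diff z (fun y => (M y)^T) (fun v => (dM v)^T).
Proof.
move=> MD i j; have := MD j i.
by congr (is_diff z _ _); apply/funext => y; rewrite mxE.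
Qed.

Lemma mx_is_diffM p q r (M dM : V -> 'M[R]_(p, q)) (N dN : V -> 'M[R]_(q, r)) :
  mx_is_diff z M dM -> mx_is_diff z N dN ->
  mx_is_diff z (fun y => M y *m N y) (fun v => dM v *m N z + M z *m dN v).
Proof.
move=> MD ND i j.
have MkD k := MD i k; have NkD k := ND k j.
have := is_diff_bigsum (index_enum 'I_q)
  (fun k => is_diffM (MkD k) (NkD k)).
congr (is_diff z _ _); apply/funext => y; rewrite !mxE //.
rewrite -big_split; apply: eq_bigr => k _ /=.
by rewrite [LHS]addrC mulrC.
Qed.

Lemma mx_is_diff_mulr p q r (M dM : V -> 'M[R]_(p, q)) (C : 'M[R]_(q, r)) :
  mx_is_diff z M dM -> mx_is_diff z (fun y => M y *m C) (fun v => dM v *m C).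
Proof.
move=> MD; have := mx_is_diffM MD (mx_is_diff_cst C).
by congr (mx_is_diff z _ _); apply/funext => v; rewrite mulmx0 addr0.
Qed.

Lemma mx_is_diff_mull p q r (C : 'M[R]_(p, q)) (M dM : V -> 'M[R]_(q, r)) :
  mx_is_diff z M dM -> mx_is_diff z (fun y => C *m M y) (fun v => C *m dM v).
Proof.
move=> MD; have := mx_is_diffM (mx_is_diff_cst C) MD.
by congr (mx_is_diff z _ _); apply/funext => v; rewrite mul0mx add0r.
Qed.

Lemma is_diff_trace p (M dM : V -> 'M[R]_p) :
  mx_is_diff z M dM -> is_diff z (fun y => \tr (M y)) (fun v => \tr (dM v)).
Proof. by move=> MD; apply: is_diff_bigsum => i; exact: MD. Qed.

Lemma differentiable_mx p q (M : V -> 'M[R]_(p, q)) :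
  differentiable M z -> mx_is_diff z M ('d M z).
Proof.
move=> MD i j.
have ijD : differentiable (fun y => M y i j) z.
  apply: (@differentiable_comp _ _ _ _ M (fun N : 'M[R]_(p, q) => N i j)) => //.
  exact: differentiable_coord.
apply: DiffDef => //; apply/funext => v.
rewrite -!deriveE// derive_mx; first by rewrite mxE.
exact: diff_derivable.
Qed.

Lemma mx_is_diff_differentiable p q (M dM : V -> 'M[R]_(p, q)) :
  mx_is_diff z M dM -> differentiable M z.
Proof.
move=> MD.
rewrite (_ : M = fun y => \sum_i \sum_j M y i j *: delta_mx i j); last first.
  by apply/funext => y; rewrite -matrix_sum_delta.
have H i j : differentiable (fun y => M y i j *: delta_mx i j : 'M[R]_(p, q)) z.
  by have MijD := MD i j; apply: differentiableZl; exact: ex_diff.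
have Hi i := is_diff_bigsum (index_enum 'I_q)
  (fun j => differentiableP (H i j)).
by have HH := is_diff_bigsum (index_enum 'I_p) Hi; exact: ex_diff.
Qed.

End MatrixDerivative.

Lemma mx_is_diffD (R : realType) (V : normedModType R) p q z
    (M dM N dN : V -> 'M[R]_(p, q)) :
  mx_is_diff z M dM -> mx_is_diff z N dN ->
  mx_is_diff z (fun y => M y + N y) (fun v => dM v + dN v).
Proof.
move=> MD ND i j; have := is_diffD (MD i j) (ND i j).
by congr (is_diff z _ _); apply/funext => y; rewrite mxE.
Qed.

Lemma mx_is_diff_id (R : realType) m (z : 'rV[R]_m) : mx_is_diff z id id.
Proof.
have D : is_diff z id id by exact: is_diff_id.
have idD : differentiable id z by exact: ex_diff.
by have := differentiable_mx idD; rewrite (diff_val (is_diff_def := D)).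
Qed.

(** With [mx_is_diff_near], this allows an identity valid near [z] to be differentiated, each side
    by its own rules. *)
Lemma mx_is_diff_unique (R : realType) (V : normedModType R) p q z
    (M dM dM' : V -> 'M[R]_(p, q)) :
  mx_is_diff z M dM -> mx_is_diff z M dM' -> dM =1 dM'.
Proof.
move=> MD MD' v; apply/matrixP => i j; have [_ E] := MD i j.
by have [_ E'] := MD' i j; rewrite -[LHS]/((fun u => dM u i j) v) -E E'.
Qed.

Lemma mx_is_diff_comp (R : realType) (V V' : normedModType R) p q z y
    (f df : V -> V') (M dM : V' -> 'M[R]_(p, q)) :
  f z = y -> is_diff z f df -> mx_is_diff y M dM ->
  mx_is_diff z (M \o f) (dM \o df).
Proof.
move=> <- fD MD i j; have MijD := MD i j.
exact: (is_diff_comp fD MijD).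
Qed.

(** * Smooth functions: symmetric second derivatives, Jacobians and Hessians *)

Section Smooth.
Variables (R : realType) (m : nat).

Lemma near_open (T : topologicalType) (U : set T) (z : T) (P : T -> Prop) :
  open U -> U z -> (forall y, U y -> P y) -> \forall y \near z, P y.
Proof. by move=> oU Uz UP; apply: filterS UP _; exact: open_nbhs_nbhs. Qed.

Variables (W : normedModType R) (U : set 'rV[R]_m) (f : 'rV[R]_m -> W).
Hypotheses (oU : open U) (fU : smooth_on U f).

Lemma smooth_differentiable z : U z -> differentiable f z.
Proof. exact: (fU [::]). Qed.

Lemma smooth_near_differentiable z :
  U z -> \forall y \near z, differentiable f y.
Proof.
by move=> Uz; apply: (near_open oU Uz) => y; exact: smooth_differentiable.
Qed.

Lemma derive_unit_row v z : differentiable f z ->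
  'D_v f z = \sum_i v 0 i *: 'D_(unit_row R i) f z.
Proof.
move=> fz; rewrite deriveE// {1}(row_sum_delta v) linear_sum.
by apply: eq_bigr => i _; rewrite linearZ deriveE.
Qed.

(** [smooth_on] only speaks of coordinate directions. On [U], where [f] is differentiable, ['D_v f]
    is a constant linear combination of coordinate partials. *)
Lemma smooth_derive_differentiable v z : U z -> differentiable ('D_v f) z.
Proof.
move=> Uz.
have E : {near z, (fun y => \sum_i v 0 i *: 'D_(unit_row R i) f y) =1 'D_v f}.
  by apply: (near_open oU Uz) => y /smooth_differentiable/(derive_unit_row v).
apply: near_eq_differentiable E _.
have D i : is_diff z (v 0 i *: 'D_(unit_row R i) f)
    (v 0 i *: ('d ('D_(unit_row R i) f) z : _ -> _)).
  by apply: is_diffZ; apply: differentiableP; exact: (fU [:: i]).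
by have H := is_diff_bigsum (index_enum 'I_m) D; exact: ex_diff.
Qed.

End Smooth.

Lemma smooth_derive_comm (R : realType) (m : nat) (U : set 'rV[R]_m)
    (f : 'rV[R]_m -> R) u v z : open U -> smooth_on U f -> U z ->
  'D_v ('D_u f) z = 'D_u ('D_v f) z.
Proof.
move=> oU fU Uz; apply: derive_comm.
- exact: smooth_near_differentiable fU _ Uz.
- exact: smooth_derive_differentiable fU _ _ Uz.
- exact: smooth_derive_differentiable fU _ _ Uz.
Qed.

Lemma smooth_row_derive_comm (R : realType) (m k : nat) (U : set 'rV[R]_m)
    (f : 'rV[R]_m -> 'rV[R]_k) u v z : open U -> smooth_on U f -> U z ->
  'D_v ('D_u f) z = 'D_u ('D_v f) z.
Proof.
move=> oU fU Uz.
have coordD (g : 'rV[R]_m -> 'rV[R]_k) w y j : differentiable g y ->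
    'D_w g y 0 j = 'D_w (fun x => g x 0 j) y.
  by move=> gy; rewrite derive_mx ?mxE//; exact: diff_derivable.
(* Taking components must commute with ['D_w] on a whole neighbourhood, since the result is
   differentiated once more. *)
have near_coordD w j :
    {near z, (fun y => 'D_w f y 0 j) =1 'D_w (fun x => f x 0 j)}.
  apply: (near_open oU Uz) => y Uy; apply: coordD.
  exact: smooth_differentiable fU _ Uy.
have fD w := smooth_derive_differentiable oU fU w Uz.
have fjD w j : differentiable (fun y => 'D_w f y 0 j) z.
  by have H := differentiable_mx (fD w) 0 j; exact: ex_diff.
apply/rowP => j.
apply: (etrans (coordD _ v _ j (fD u))).
apply: (etrans _ (esym (coordD _ u _ j (fD v)))).
apply: (etrans (near_eq_derive v (near_coordD u j))).
apply: (etrans _ (esym (near_eq_derive u (near_coordD v j)))).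
apply: derive_comm.
- apply: (near_open oU Uz) => y /(smooth_differentiable fU) fy.
  by have H := differentiable_mx fy 0 j; exact: ex_diff.
- exact: near_eq_differentiable (near_coordD u j) _.
- exact: near_eq_differentiable (near_coordD v j) _.
Qed.

(** In the row convention [u *m dJ v] is the second derivative of [f] along [u] and [v], hence the
    symmetry. This clause is what later expresses that pullback commutes with the exterior
    derivative. *)
Lemma smooth_jacobian (R : realType) (m k : nat) (U : set 'rV[R]_m)
    (f : 'rV[R]_m -> 'rV[R]_k) z : open U -> smooth_on U f -> U z ->
  exists dJ : 'rV[R]_m -> 'M[R]_(m, k), mx_is_diff z (jacobian f) dJ /\
    forall u v, u *m dJ v = v *m dJ u.
Proof.
move=> oU fU Uz.
pose dJ v := \matrix_i 'D_v ('D_(unit_row R i) f) z.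
have dJE u v : u *m dJ v = 'D_u ('D_v f) z.
  have vD := smooth_derive_differentiable oU fU v Uz.
  rewrite (derive_unit_row u vD) mulmx_sum_row; apply: eq_bigr => i _.
  by rewrite rowK (smooth_row_derive_comm (unit_row R i) v oU fU Uz).
exists dJ; split => [|u v]; last first.
  by rewrite !dJE (smooth_row_derive_comm v u oU fU Uz).
move=> i j; have iD := smooth_derive_differentiable oU fU (unit_row R i) Uz.
apply: (@near_eq_is_diff _ _ _ (fun y => 'D_(unit_row R i) f y 0 j)).
  apply: (near_open oU Uz) => y Uy.
  by rewrite mxE deriveE//; exact: smooth_differentiable fU _ Uy.
apply: (is_diff_eq (differentiable_mx iD 0 j)); apply/funext => v.
by rewrite mxE deriveE.
Qed.

Definition gradient (R : realType) (m : nat) (f : 'rV[R]_m -> R)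
  (z : 'rV[R]_m) : 'rV[R]_m := \row_j 'd f z (unit_row R j).

(** [S] is the Hessian of [f] at [z], symmetric by [smooth_derive_comm]. *)
Lemma smooth_gradient (R : realType) (m : nat) (U : set 'rV[R]_m)
    (f : 'rV[R]_m -> R) z : open U -> smooth_on U f -> U z ->
  exists2 S : 'M[R]_m, S^T = S & mx_is_diff z (gradient f) (fun v => v *m S).
Proof.
move=> oU fU Uz.
exists (\matrix_(i, j) 'D_(unit_row R i) ('D_(unit_row R j) f) z).
  by apply/matrixP => i j; rewrite !mxE; exact: smooth_derive_comm fU Uz.
move=> i j; rewrite (ord1 i) => {i}.
have jD := smooth_derive_differentiable oU fU (unit_row R j) Uz.
apply: (@near_eq_is_diff _ _ _ ('D_(unit_row R j) f)).
  apply: (near_open oU Uz) => y Uy.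
  by rewrite mxE deriveE//; exact: smooth_differentiable fU _ Uy.
apply: DiffDef => //; apply/funext => v.
rewrite -deriveE// (derive_unit_row v jD) mxE.
by apply: eq_bigr => i _; rewrite mxE.
Qed.

(** * The Lax equation in coordinates *)

Lemma pairingE (R : realType) (m : nat) (a v : 'rV[R]_m) :
  pairing a v = (a *m v^T) 0 0.
Proof. by rewrite mxE; apply: eq_bigr => i _; rewrite mxE. Qed.

Lemma mulmx_unit_rows (R : realType) (m : nat) (B C : 'M[R]_m) :
  (forall u v : 'rV[R]_m, (u *m B *m v^T) 0 0 = (u *m C *m v^T) 0 0) -> B = C.
Proof.
move=> BC; apply/matrixP => i j.
have := BC (delta_mx 0 i) (delta_mx 0 j).
by rewrite -!rowE trmx_delta -!colE !mxE.
Qed.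

(** Applied to the 1 by 1 matrix [u *m B *m v^T], it exchanges [u] and [v] at the price of
    transposing [B]. *)
Lemma scalar_mx_tr (R : realType) (B : 'M[R]_1) : B^T 0 0 = B 0 0.
Proof. by rewrite mxE. Qed.

(* A Lax equation [D_X M = [M, B]] is inherited by the powers of [M], whose
   traces therefore have zero derivative along [X]. *)
Lemma lax_power (R : realType) (V : normedModType R) (m : nat) (z X : V)
    (M dM : V -> 'M[R]_m) (B : 'M[R]_m) (l : nat) :
  mx_is_diff z M dM -> dM X = M z *m B - B *m M z ->
  exists2 dP, mx_is_diff z (fun y => iter l (mulmx (M y)) 1%:M) dP &
    dP X = iter l (mulmx (M z)) 1%:M *m B - B *m iter l (mulmx (M z)) 1%:M.
Proof.
move=> MD MX; elim: l => [|l [dP PD PX]] /=.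
  exists (fun=> 0); first exact: mx_is_diff_cst.
  by rewrite mul1mx mulmx1 subrr.
exists (fun v => dM v *m iter l (mulmx (M z)) 1%:M + M z *m dP v).
  exact: mx_is_diffM MD PD.
by rewrite PX MX mulmxBl mulmxBr !mulmxA addrC addrA subrK.
Qed.

Section LocalInvariance.
Variables (R : realType) (m : nat) (U : set 'rV[R]_m).
Variables (J : 'M[R]_m) (F : 'rV[R]_m -> 'rV[R]_m) (G : 'rV[R]_m -> R).
Hypotheses (Junit : J \in unitmx) (Janti : J^T = - J).
Hypotheses (oU : open U) (FU : smooth_on U F) (GU : smooth_on U G).

Let K := invmx J.
Let W z := jacobian F z *m J *m (jacobian F z)^T.
Let X z := gradient G z *m K.

(** The hypothesis is the vanishing of the exterior derivative of the contraction of [W] with [X].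
    By the product rule it contains Hessian terms, from differentiating [X], and derivatives of [W],
    which closedness of [W] recombines into the derivative along [X]. The outcome is a Lax equation
    for [K *m W], and a commutator has trace zero. *)
Lemma trace_power_invariant (l : nat) (z : 'rV[R]_m) : U z ->
  (forall u v, 'D_u (fun y => pairing (X y *m W y) v) z -
               'D_v (fun y => pairing (X y *m W y) u) z = 0) ->
  exists2 df, is_diff z (fun y => \tr (iter l (mulmx (K *m W y)) 1%:M)) df &
    df (X z) = 0.
Proof.
move=> Uz closed.
have Kanti : K^T = - K.
  apply: (can_inj (mulmxK Junit)).
  rewrite mulNmx mulVmx// -[in LHS](opprK J) -Janti mulmxN -trmx_mul.
  by rewrite mulmxV// trmx1.
have [dD [DD dD_sym]] := smooth_jacobian oU FU Uz.
have [S S_sym gradD] := smooth_gradient oU GU Uz.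
pose D := jacobian F.
pose dW w := dD w *m J *m (D z)^T + D z *m J *m (dD w)^T.
have WD : mx_is_diff z W dW.
  exact: mx_is_diffM (mx_is_diff_mulr J DD) (mx_is_diff_tr DD).
have XD : mx_is_diff z X (fun w => w *m S *m K) := mx_is_diff_mulr K gradD.
have Wanti : (W z)^T = - W z.
  by rewrite /W !trmx_mul trmxK Janti mulNmx mulmxN mulmxA.
have pairD u v : 'D_u (fun y => pairing (X y *m W y) v) z =
    (u *m S *m K *m W z *m v^T) 0 0 + (X z *m dW u *m v^T) 0 0.
  have D00 := mx_is_diff_mulr v^T (mx_is_diffM XD WD) 0 0.
  rewrite (_ : (fun y => _) = fun y => (X y *m W y *m v^T) 0 0); last first.
    by apply/funext => y; rewrite pairingE.
  by rewrite deriveE// diff_val mulmxDl mxE.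
pose bf (a b : 'rV[R]_m) : R := (a *m J *m b^T) 0 0.
have bfC a b : bf a b = - bf b a.
  by rewrite /bf -scalar_mx_tr !trmx_mul trmxK Janti mulNmx mulmxN mulmxA mxE.
have dWE u v w : (u *m dW w *m v^T) 0 0 =
    bf (u *m dD w) (v *m D z) + bf (u *m D z) (v *m dD w).
  by rewrite /bf mulmxDr mulmxDl mxE !trmx_mul !mulmxA.
(* This is closedness of [W] on the triple of [X z], [u] and [v]: the second derivatives of [F] are
   symmetric and [bf] is antisymmetric, so the remaining terms cancel. *)
have cyclic u v : (X z *m dW u *m v^T) 0 0 - (X z *m dW v *m u^T) 0 0 =
    (u *m dW (X z) *m v^T) 0 0.
  rewrite !dWE (dD_sym (X z) u) (dD_sym (X z) v) (dD_sym v u).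
  rewrite (bfC (v *m dD _)) (bfC (u *m dD (X z))) (bfC (u *m D z)).
  ring.
(* This says that the Lie derivative of [W] along [X] vanishes: [X] has linearisation [S *m K],
   whose transpose is [- (K *m S)]. *)
have lie : dW (X z) = W z *m K *m S - S *m K *m W z.
  apply: mulmx_unit_rows => u v.
  have swap : (v *m S *m K *m W z *m u^T) 0 0 = (u *m W z *m K *m S *m v^T) 0 0.
    rewrite -scalar_mx_tr trmx_mul trmxK [(_ *m W z)^T]trmx_mul Wanti.
    rewrite [(_ *m K)^T]trmx_mul Kanti [(_ *m S)^T]trmx_mul S_sym.
    by rewrite !mulNmx !mulmxN opprK !mulmxA.
  have -> : (u *m (W z *m K *m S - S *m K *m W z) *m v^T) 0 0 =
      (u *m W z *m K *m S *m v^T) 0 0 - (u *m S *m K *m W z *m v^T) 0 0.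
    by rewrite mulmxBr mulmxBl !mulmxA [LHS]mxE; congr (_ + _); rewrite mxE.
  have := closed u v; rewrite !pairD swap -cyclic.
  move: (_ 0 0) (_ 0 0) (_ 0 0) (_ 0 0) => a b c d; lra.
have lax : K *m dW (X z) = K *m W z *m (K *m S) - K *m S *m (K *m W z).
  by rewrite lie mulmxBr !mulmxA.
have [dP PD PX] := lax_power l (mx_is_diff_mull K WD) lax.
exists (fun v => \tr (dP v)); first exact: is_diff_trace.
by rewrite PX linearB /= mxtrace_mulC subrr.
Qed.

End LocalInvariance.

(** * Changes of chart *)

Section Jacobian.
Variable R : realType.

Lemma mul_jacobian m k (f : 'rV[R]_m -> 'rV[R]_k) z v :
  v *m jacobian f z = 'd f z v.
Proof. by rewrite /jacobian mul_rV_lin1. Qed.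

Lemma jacobian_eq m k (f : 'rV[R]_m -> 'rV[R]_k) z (B : 'M[R]_(m, k)) :
  (forall v, 'd f z v = v *m B) -> jacobian f z = B.
Proof. by move=> fB; apply/row_matrixP => i; rewrite !rowE mul_jacobian fB. Qed.

Lemma jacobian_comp m k l (f : 'rV[R]_m -> 'rV[R]_k) (g : 'rV[R]_k -> 'rV[R]_l)
    z y : f z = y -> differentiable f z -> differentiable g y ->
  jacobian (g \o f) z = jacobian f z *m jacobian g y.
Proof.
move=> <- fD gD; apply: jacobian_eq => v.
by rewrite diff_comp// mulmxA !mul_jacobian.
Qed.

Lemma near_eq_jacobian m k (f g : 'rV[R]_m -> 'rV[R]_k) z :
  {near z, f =1 g} -> differentiable f z -> jacobian f z = jacobian g z.
Proof.
move=> fg fD; apply: jacobian_eq => v.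
by rewrite (near_eq_diff fg fD) mul_jacobian.
Qed.

Lemma jacobian_id m (z : 'rV[R]_m) : jacobian id z = 1%:M.
Proof. by apply: jacobian_eq => v; rewrite diff_val mulmx1. Qed.

End Jacobian.

(** Covectors are rows as well and pair by [a *m v^T], so the transpose of the tangent matrix acts
    on them from the right. *)
Lemma cotangent_map_mulmx (R : realType) (m k : nat) (M N : Type)
    (A : atlas R m M) (B : atlas R k N) (f : M -> N) (x : M)
    (a : cotangent B (f x)) (T : 'M[R]_(m, k)) :
  (forall v, tangent_map A B f x v = v *m T) ->
  cotangent_map A B f x a = (a : 'rV[R]_k) *m T^T.
Proof.
move=> fT; apply/rowP => j; rewrite mxE fT pairingE trmx_mul mulmxA.
by rewrite /unit_row trmx_delta -colE mxE.
Qed.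

(* The part of the manifold axioms that makes first derivatives transform
   tensorially; it holds for [Q] and for its cotangent bundle, which carries no
   topology here. *)
Record diff_atlas (R : realType) (m : nat) (M : Type) (A : atlas R m M) :
    Prop := DiffAtlas {
  diff_atlas_at : forall x,
    charts A (chart_at A x) /\ chart_dom (chart_at A x) x;
  diff_atlas_coordK : forall c, charts A c ->
    forall x, chart_dom c x -> chart_inv c (chart_coord c x) = x;
  diff_atlas_open : forall c d, charts A c -> charts A d ->
    open (chart_coord c @` (chart_dom c `&` chart_dom d));
  diff_atlas_transition : forall c d, charts A c -> charts A d ->
    forall x, chart_dom c x -> chart_dom d x ->
    differentiable (chart_coord d \o chart_inv c) (chart_coord c x) }.

(** When one of the charts is [chart_at A x], this matrix converts between the frame in which
    tangent vectors at [x] are stored and the frame of the other chart. *)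
Definition transition_mx (R : realType) (m : nat) (M : Type)
    (c d : chart R m M) (x : M) : 'M[R]_m :=
  jacobian (chart_coord d \o chart_inv c) (chart_coord c x).

Section DiffAtlas.
Variables (R : realType) (m : nat) (M : Type) (A : atlas R m M).
Hypothesis hA : diff_atlas A.

Lemma near_chart c d x : charts A c -> charts A d ->
  chart_dom c x -> chart_dom d x ->
  \forall z \near chart_coord c x, exists y, [/\ chart_coord c y = z,
    chart_inv c z = y, chart_dom c y & chart_dom d y].
Proof.
move=> Ac Ad cx dx; apply: (near_open (diff_atlas_open hA Ac Ad)).
  by exists x.
by move=> _ [y [cy dy] <-]; exists y; rewrite (diff_atlas_coordK hA).
Qed.

Lemma chart_transition (c d : chart R m M) x : charts A c -> chart_dom c x ->
  (chart_coord d \o chart_inv c) (chart_coord c x) = chart_coord d x.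
Proof. by move=> Ac cx; rewrite /= (diff_atlas_coordK hA). Qed.

(** The cocycle rule is the chain rule; the composite of the two transitions agrees with the direct
    one only near the point, on the image of the overlap. *)
Lemma transition_mx_chain c d e x : charts A c -> charts A d -> charts A e ->
  chart_dom c x -> chart_dom d x -> chart_dom e x ->
  transition_mx c d x *m transition_mx d e x = transition_mx c e x.
Proof.
move=> Ac Ad Ae cx dx ex; rewrite /transition_mx.
have cdD := diff_atlas_transition hA Ac Ad cx dx.
have deD := diff_atlas_transition hA Ad Ae dx ex.
have cdx := chart_transition d Ac cx.
rewrite -(jacobian_comp cdx cdD deD).
apply: near_eq_jacobian; last by apply: differentiable_comp; rewrite ?cdx.
apply: filterS (near_chart Ac Ad cx dx) => _ [y [<- cy _ dy]] /=.
by rewrite cy (diff_atlas_coordK hA).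
Qed.

Lemma transition_mx_id c x : charts A c -> chart_dom c x ->
  transition_mx c c x = 1%:M.
Proof.
move=> Ac cx; rewrite /transition_mx -(jacobian_id (chart_coord c x)).
have cD := diff_atlas_transition hA Ac Ac cx cx.
apply: near_eq_jacobian; last exact: cD.
by apply: filterS (near_chart Ac Ac cx cx) => _ [y [<- /= -> _ _]].
Qed.

Lemma transition_mxV c d x : charts A c -> charts A d ->
  chart_dom c x -> chart_dom d x ->
  transition_mx c d x *m transition_mx d c x = 1%:M.
Proof.
by move=> Ac Ad cx dx; rewrite transition_mx_chain// transition_mx_id.
Qed.

Lemma tangent_map_chart_inv c x v : charts A c -> chart_dom c x ->
  tangent_map (model_atlas R m) A (chart_inv c) (chart_coord c x) v =
  v *m transition_mx c (chart_at A x) x.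
Proof.
move=> Ac cx; rewrite /transition_mx mul_jacobian /tangent_map.
by rewrite (diff_atlas_coordK hA Ac cx).
Qed.

Lemma tangent_map_chart_coord c x v :
  tangent_map A (model_atlas R m) (chart_coord c) x v =
  v *m transition_mx (chart_at A x) c x.
Proof. by rewrite /transition_mx mul_jacobian. Qed.

Lemma local_jacobian (f : M -> M) c d x : charts A c -> charts A d ->
  chart_dom c x -> chart_dom d x -> chart_dom c (f x) -> chart_dom d (f x) ->
  (\forall z \near chart_coord c x, chart_dom c (f (chart_inv c z))) ->
  differentiable (chart_coord c \o f \o chart_inv c) (chart_coord c x) ->
  differentiable (chart_coord d \o f \o chart_inv d) (chart_coord d x) ->
  jacobian (chart_coord c \o f \o chart_inv c) (chart_coord c x) *m
    transition_mx c d (f x) =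
  transition_mx c d x *m
    jacobian (chart_coord d \o f \o chart_inv d) (chart_coord d x).
Proof.
move=> Ac Ad cx dx cfx dfx near_f fcD fdD; rewrite /transition_mx.
have cdD := diff_atlas_transition hA Ac Ad cx dx.
have fcdD := diff_atlas_transition hA Ac Ad cfx dfx.
have cdx := chart_transition d Ac cx.
have fcx : (chart_coord c \o f \o chart_inv c) (chart_coord c x) =
    chart_coord c (f x) by exact: congr1 (diff_atlas_coordK hA Ac cx).
apply: (etrans (esym (jacobian_comp fcx fcD fcdD))).
apply: (etrans _ (jacobian_comp cdx cdD fdD)).
apply: near_eq_jacobian; last by apply: differentiable_comp; rewrite ?fcx.
apply: filterS2 near_f (near_chart Ac Ad cx dx) => z cfz [y [_ cy _ dy]].
rewrite /= in cy *; rewrite cy in cfz *.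
by rewrite (diff_atlas_coordK hA Ac cfz) (diff_atlas_coordK hA Ad dy).
Qed.

Lemma local_diff (f : M -> R) c d x v : charts A c -> charts A d ->
  chart_dom c x -> chart_dom d x ->
  differentiable (f \o chart_inv d) (chart_coord d x) ->
  'd (f \o chart_inv c) (chart_coord c x) v =
  'd (f \o chart_inv d) (chart_coord d x) (v *m transition_mx c d x).
Proof.
move=> Ac Ad cx dx fD; rewrite /transition_mx mul_jacobian.
have cdD := diff_atlas_transition hA Ac Ad cx dx.
have cdx := chart_transition d Ac cx.
have fD' : differentiable (f \o chart_inv d)
    ((chart_coord d \o chart_inv c) (chart_coord c x)) by rewrite cdx.
rewrite -cdx; apply: (etrans _ (congr1 (@^~ v) (diff_comp cdD fD'))).
apply: esym; move: v; apply/funeqP.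
apply: near_eq_diff (differentiable_comp cdD fD').
apply: filterS (near_chart Ac Ad cx dx) => _ [y [<- /= cy _ dy]].
by rewrite cy (diff_atlas_coordK hA).
Qed.

End DiffAtlas.

Lemma smooth_manifold_diff_atlas (R : realType) (m : nat) (M : topologicalType)
  (A : atlas R m M) : smooth_manifold A -> diff_atlas A.
Proof.
move=> hA; split; first exact: chart_atP hA; first exact: coordK hA.
  move=> c d Ac Ad.
  (* Rewritten this way, openness at a point follows from the open image of [c] and the continuity
     of [chart_inv c] at that point of the image. *)
  have -> : chart_coord c @` (chart_dom c `&` chart_dom d) =
      chart_coord c @` chart_dom c `&` chart_inv c @^-1` chart_dom d.
    apply/seteqP; split=> [_ [x [cx dx] <-]|_ [[x cx <-] /=]].
      by split; [exists x | rewrite /= (coordK hA)].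
    by rewrite (coordK hA)// => dx; exists x.
  rewrite openE => z [cz dz]; rewrite /interior /=.
  apply: filterI; first exact: open_nbhs_nbhs (conj (open_image hA Ac) cz).
  apply: (continuous_inv_coord hA Ac cz).
  exact: open_nbhs_nbhs (conj (open_dom hA Ad) dz).
move=> c d Ac Ad x cx dx.
by apply: (smooth_transition hA Ac Ad [::]); exists x.
Qed.

(** * Changes of chart on the cotangent bundle *)

Section CanonicalMatrix.
Variables (R : realType) (n : nat).

(** Right multiplication by [fst_mx] and [snd_mx] extracts the q and p parts, and by their
    transposes injects them. Block operations thus become products, to which the matrix product rule
    applies. *)
Definition fst_mx : 'M[R]_(n + n, n) := col_mx 1%:M 0.
Definition snd_mx : 'M[R]_(n + n, n) := col_mx 0 1%:M.

(* [u *m canonical_mx *m v^T] is [dq^i /\ dp_i (u, v)]. *)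
Definition canonical_mx : 'M[R]_(n + n) :=
  fst_mx *m snd_mx^T - snd_mx *m fst_mx^T.

Lemma mul_fst_mx k (v : 'M[R]_(k, n + n)) : v *m fst_mx = lsubmx v.
Proof. by rewrite -{1}(hsubmxK v) mul_row_col mulmx1 mulmx0 addr0. Qed.

Lemma mul_snd_mx k (v : 'M[R]_(k, n + n)) : v *m snd_mx = rsubmx v.
Proof. by rewrite -{1}(hsubmxK v) mul_row_col mulmx1 mulmx0 add0r. Qed.

Lemma tr_fst_mx : fst_mx^T = row_mx 1%:M 0.
Proof. by rewrite tr_col_mx trmx1 trmx0. Qed.

Lemma tr_snd_mx : snd_mx^T = row_mx 0 1%:M.
Proof. by rewrite tr_col_mx trmx1 trmx0. Qed.

Lemma row_mxE k (a b : 'M[R]_(k, n)) :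
  row_mx a b = a *m fst_mx^T + b *m snd_mx^T.
Proof.
rewrite tr_fst_mx tr_snd_mx !mul_mx_row !mulmx1 !mulmx0 add_row_mx.
by rewrite addr0 add0r.
Qed.

Lemma canonical_mx_anti : canonical_mx^T = - canonical_mx.
Proof. by rewrite /canonical_mx linearB /= !trmx_mul !trmxK opprB. Qed.

Lemma canonical_mx_unit : canonical_mx \in unitmx.
Proof.
have E : canonical_mx = block_mx 0 1%:M (- 1%:M) 0.
  rewrite /canonical_mx tr_fst_mx tr_snd_mx !mul_col_mx !mul1mx !mul0mx.
  by rewrite opp_col_mx add_col_mx opp_row_mx !oppr0 addr0 add0r.
suff : canonical_mx *m (- canonical_mx) = 1%:M by case/mulmx1_unit.
rewrite E opp_block_mx mulmx_block !opprK !oppr0 !mulmx0 !mul0mx !mulmx1 !addr0.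
by rewrite !add0r mulmxN mulmx1 opprK -scalar_mx_block.
Qed.

Lemma jacobian_lsubmx (z : 'rV[R]_(n + n)) : jacobian lsubmx z = fst_mx.
Proof.
apply: jacobian_eq => v; rewrite mul_fst_mx diff_lin //.
exact: continuous_lsubmx.
Qed.

End CanonicalMatrix.

Section CotangentBundle.
Variables (R : realType) (n : nat) (Q : topologicalType) (A : atlas R n Q).
Hypothesis hQ : smooth_manifold A.

Let hA := smooth_manifold_diff_atlas hQ.
Local Notation TQ := (cotangent_bundle A).
Local Notation B := (cotangent_atlas A).
Local Notation cc := (cotangent_chart A).
Local Notation P := (fst_mx R n).
Local Notation N := (snd_mx R n).
Local Notation J := (canonical_mx R n).

(** Every [cotangent A q] unfolds to the same type of rows, so fibre components over different base
    points compare without transport. *)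
Lemma cotangent_bundle_eq (q q' : Q) (a a' : 'rV[R]_n) : q = q' -> a = a' ->
  existT (cotangent A) q a = existT (cotangent A) q' a' :> TQ.
Proof. by move=> -> ->. Qed.

Lemma cotangent_chart_coordE c (x : TQ) : charts A c ->
  chart_dom c (bundle_proj x) ->
  chart_coord (cc c) x = row_mx (chart_coord c (bundle_proj x))
    ((projT2 x : 'rV[R]_n) *m
     (transition_mx c (chart_at A (bundle_proj x)) (bundle_proj x))^T).
Proof.
move=> Ac cx; congr row_mx; apply: cotangent_map_mulmx => v.
exact: tangent_map_chart_inv.
Qed.

Lemma cotangent_chart_invE c z q : chart_inv c (lsubmx z) = q ->
  chart_inv (cc c) z = existT (cotangent A) q
    (rsubmx z *m (transition_mx (chart_at A q) c q)^T).
Proof.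
move=> <-; apply: cotangent_bundle_eq => //; apply: cotangent_map_mulmx => v.
exact: tangent_map_chart_coord.
Qed.

Lemma cotangent_chart_coordK c (x : TQ) : charts A c ->
  chart_dom c (bundle_proj x) -> chart_inv (cc c) (chart_coord (cc c) x) = x.
Proof.
move=> Ac cx; rewrite (cotangent_chart_coordE Ac cx).
have [Aq qx] := diff_atlas_at hA (bundle_proj x).
rewrite (@cotangent_chart_invE _ _ (bundle_proj x)); last first.
  by rewrite row_mxKl (diff_atlas_coordK hA).
rewrite row_mxKr -mulmxA -trmx_mul (transition_mxV hA)// trmx1 mulmx1.
by case: x {cx Aq qx}.
Qed.

(** The fibre coordinate passes through the preferred chart at [q], which the cocycle rule
    eliminates, leaving the usual contragredient law. *)
Lemma cotangent_transitionE c d q z : charts A c -> charts A d ->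
  chart_dom c q -> chart_dom d q -> lsubmx z = chart_coord c q ->
  (chart_coord (cc d) \o chart_inv (cc c)) z =
  row_mx (chart_coord d q) (rsubmx z *m (transition_mx d c q)^T).
Proof.
move=> Ac Ad cq dq zq; rewrite /comp (@cotangent_chart_invE _ _ q); last first.
  by rewrite zq (diff_atlas_coordK hA).
have [Aq qq] := diff_atlas_at hA q.
apply: (etrans (@cotangent_chart_coordE d (existT _ q _) Ad dq)).
rewrite /= /bundle_proj /= -mulmxA -trmx_mul.
by rewrite (transition_mx_chain hA Ad Aq Ac dq qq cq).
Qed.

(** Induced charts are onto along the fibres, so an overlap is the full cylinder over the base
    overlap; openness follows. *)
Lemma cotangent_overlap c d : charts A c -> charts A d ->
  chart_coord (cc c) @` (chart_dom (cc c) `&` chart_dom (cc d)) =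
  lsubmx @^-1` (chart_coord c @` (chart_dom c `&` chart_dom d)).
Proof.
move=> Ac Ad; apply/seteqP; split=> [_ [x [cx dx] <-]|z [q [cq dq] zq]].
  exists (bundle_proj x) => //.
  by rewrite (cotangent_chart_coordE Ac cx) row_mxKl.
exists (chart_inv (cc c) z).
  by rewrite (cotangent_chart_invE (q := q)) -?zq ?(diff_atlas_coordK hA).
have := cotangent_transitionE Ac Ac cq cq (esym zq).
by rewrite /= => ->; rewrite (transition_mx_id hA)// trmx1 mulmx1 zq hsubmxK.
Qed.

Lemma cotangent_overlap_open c d : charts A c -> charts A d ->
  open (chart_coord (cc c) @` (chart_dom (cc c) `&` chart_dom (cc d))).
Proof.
move=> Ac Ad; rewrite cotangent_overlap//.
apply: open_comp; last exact (diff_atlas_open hA Ac Ad).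
by move=> z _; exact: continuous_lsubmx.
Qed.

(** * Changes of natural coordinates: differentiability and symplecticity *)

Section Transition.
Variables c d : chart R n Q.
Hypotheses (Ac : charts A c) (Ad : charts A d).

Let F := chart_coord (cc d) \o chart_inv (cc c).
Let phi := chart_coord d \o chart_inv c.
Let psi := chart_coord c \o chart_inv d.

Lemma near_cotangent_overlap (z : 'rV[R]_(n + n)) q :
  chart_dom c q -> chart_dom d q -> lsubmx z = chart_coord c q ->
  \forall y \near z, exists q', [/\ chart_dom c q', chart_dom d q' &
    lsubmx y = chart_coord c q'].
Proof.
move=> cq dq zq; apply: (near_open (cotangent_overlap_open Ac Ad)).
  by rewrite cotangent_overlap// /preimage /=; exists q.
by rewrite cotangent_overlap// => y [q' [cq' dq'] <-]; exists q'.
Qed.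

Lemma base_transition_differentiable (z : 'rV[R]_(n + n)) q :
  chart_dom c q -> chart_dom d q -> lsubmx z = chart_coord c q ->
  differentiable (phi \o lsubmx) z /\ (phi \o lsubmx) z = chart_coord d q.
Proof.
move=> cq dq zq; split; last by rewrite /phi /= zq (diff_atlas_coordK hA).
apply: differentiable_comp; first exact: differentiable_lsubmx.
by rewrite zq; exact (diff_atlas_transition hA Ac Ad cq dq).
Qed.

(** The base point is eliminated here: the transition becomes a matrix formula in the coordinates
    alone, ready to be differentiated. *)
Lemma cotangent_transition_near (z : 'rV[R]_(n + n)) q :
  chart_dom c q -> chart_dom d q -> lsubmx z = chart_coord c q ->
  {near z, (fun y => (phi \o lsubmx) y *m P^T +
     y *m N *m ((jacobian psi \o (phi \o lsubmx)) y)^T *m N^T) =1 F}.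
Proof.
move=> cq dq zq.
apply: filterS (near_cotangent_overlap cq dq zq) => y [q' [cq' dq' yq']].
have [_ phiy] := base_transition_differentiable cq' dq' yq'.
rewrite /F (cotangent_transitionE Ac Ad cq' dq' yq') row_mxE mul_snd_mx.
by rewrite -[(_ \o (phi \o _)) y]/(jacobian psi ((phi \o lsubmx) y)) phiy.
Qed.

(** The fibre part contains [jacobian psi], so a second derivative of the base transition is
    required; [smooth_jacobian] supplies it. *)
Lemma cotangent_transition_differentiable (z : 'rV[R]_(n + n)) q :
  chart_dom c q -> chart_dom d q -> lsubmx z = chart_coord c q ->
  differentiable F z.
Proof.
move=> cq dq zq.
apply: near_eq_differentiable (cotangent_transition_near cq dq zq) _.
have [phiD phiz] := base_transition_differentiable cq dq zq.
have [dJ [JD _]] := smooth_jacobian (diff_atlas_open hA Ad Ac)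
  (smooth_transition hQ Ad Ac) (ex_intro2 _ _ q (conj dq cq) erefl).
have psiD := mx_is_diff_comp phiz (differentiableP phiD) JD.
have idD := mx_is_diff_mulr N (mx_is_diff_id z).
have := mx_is_diffD (mx_is_diff_mulr P^T (differentiable_mx phiD))
  (mx_is_diff_mulr N^T (mx_is_diffM idD (mx_is_diff_tr psiD))).
exact: mx_is_diff_differentiable.
Qed.

(** Both sides are Jacobians of the same map near [z], because [F] covers [phi]: [lsubmx \o F]
    agrees with [phi \o lsubmx]. *)
Lemma jacobian_transition_fst (z : 'rV[R]_(n + n)) q :
  chart_dom c q -> chart_dom d q -> lsubmx z = chart_coord c q ->
  jacobian F z *m P = P *m jacobian phi (chart_coord c q).
Proof.
move=> cq dq zq.
have FD := cotangent_transition_differentiable cq dq zq.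
have phiD := diff_atlas_transition hA Ac Ad cq dq.
have lD (y : 'rV[R]_(n + n)) : differentiable lsubmx y.
  exact: differentiable_lsubmx.
rewrite -{2}(jacobian_lsubmx z) -(jacobian_comp zq (lD z) phiD).
rewrite -(jacobian_lsubmx (F z)) -(jacobian_comp erefl FD (lD _)).
apply: near_eq_jacobian; last exact: differentiable_comp FD (lD _).
apply: filterS (near_cotangent_overlap cq dq zq) => y [q' [cq' dq' yq']].
apply: (etrans (congr1 lsubmx (cotangent_transitionE Ac Ad cq' dq' yq'))).
by rewrite row_mxKl /phi /= yq' (diff_atlas_coordK hA).
Qed.

(* Invariance of the tautological form p_i dq^i under a change of chart. *)
Lemma transition_tautological (z : 'rV[R]_(n + n)) q :
  chart_dom c q -> chart_dom d q -> lsubmx z = chart_coord c q ->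
  F z *m N *m (jacobian F z *m P)^T = z *m N *m P^T.
Proof.
move=> cq dq zq; rewrite (jacobian_transition_fst cq dq zq).
rewrite /F (cotangent_transitionE Ac Ad cq dq zq) mul_snd_mx row_mxKr.
rewrite trmx_mul mulmxA -[_ *m _ *m (jacobian _ _)^T]mulmxA -trmx_mul.
by rewrite (transition_mxV hA Ac Ad cq dq) trmx1 mulmx1 mul_snd_mx.
Qed.

(** The invariance of the tautological form is differentiated and then antisymmetrised in the two
    tangent vectors. *)
Lemma jacobian_transition_symplectic (z : 'rV[R]_(n + n)) q :
  chart_dom c q -> chart_dom d q -> lsubmx z = chart_coord c q ->
  jacobian F z *m J *m (jacobian F z)^T = J.
Proof.
move=> cq dq zq.
have FD := cotangent_transition_differentiable cq dq zq.
have [dJ [JD dJ_sym]] := smooth_jacobian (diff_atlas_open hA Ac Ad)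
  (smooth_transition hQ Ac Ad) (ex_intro2 _ _ q (conj cq dq) erefl).
have lD : differentiable lsubmx z by exact: differentiable_lsubmx.
have BD := mx_is_diff_mull P (mx_is_diff_comp zq (differentiableP lD) JD).
have lhsD := mx_is_diffM (mx_is_diff_mulr N (differentiable_mx FD))
  (mx_is_diff_tr BD).
have idD := mx_is_diff_mulr P^T (mx_is_diff_mulr N (mx_is_diff_id z)).
(* With [jacobian F y *m P] replaced by its expression through [phi], only second derivatives of the
   base transition appear. *)
have nearE : {near z, (fun y => F y *m N *m
    (P *m (jacobian phi \o lsubmx) y)^T) =1 fun y => y *m N *m P^T}.
  apply: filterS (near_cotangent_overlap cq dq zq) => y [q' [cq' dq' yq']].
  rewrite -(transition_tautological cq' dq' yq').
  by rewrite (jacobian_transition_fst cq' dq' yq') /comp yq'.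
have /= E := mx_is_diff_unique (mx_is_diff_near nearE lhsD) idD.
have Dlsubmx w : 'd lsubmx z w = w *m P.
  by rewrite -mul_jacobian jacobian_lsubmx.
have DP : P *m jacobian phi (lsubmx z) = jacobian F z *m P.
  by rewrite (jacobian_transition_fst cq dq zq) zq.
pose D := jacobian F z; pose NP := N *m P^T.
(* The last term carries the second derivative of [phi]; it is symmetric in [w] and [w'] by [dJ_sym]
   and drops out on antisymmetrising. *)
have half (w w' : 'rV[R]_(n + n)) : (w *m (D *m NP *m D^T) *m w'^T) 0 0 =
    (w *m NP *m w'^T) 0 0 - (F z *m N *m (w' *m P *m dJ (w *m P))^T) 0 0.
  have := congr1 (fun B => (B *m w'^T) 0 0) (E w).
  rewrite DP Dlsubmx -mul_jacobian !trmx_mul mulmxDl [LHS]mxE !mulmxA => <-.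
  by rewrite addrK.
have alt (u v : 'rV[R]_(n + n)) (B : 'M[R]_(n + n)) :
    (u *m (B^T - B) *m v^T) 0 0 = (v *m B *m u^T) 0 0 - (u *m B *m v^T) 0 0.
  rewrite mulmxBr mulmxBl [LHS]mxE -[(v *m B *m u^T) 0 0]scalar_mx_tr.
  by rewrite !trmx_mul trmxK mulmxA; congr (_ + _); rewrite mxE.
have JE : J = NP^T - NP by rewrite /NP trmx_mul trmxK.
have DJE : D *m J *m D^T = (D *m NP *m D^T)^T - D *m NP *m D^T.
  have trE (B : 'M[R]_(n + n)) : D *m B^T *m D^T = (D *m B *m D^T)^T.
    by rewrite !trmx_mul trmxK mulmxA.
  by rewrite JE mulmxBr mulmxBl trE.
apply: mulmx_unit_rows => u v; rewrite DJE JE !alt !half dJ_sym; ring.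
Qed.

End Transition.

End CotangentBundle.

(** * The canonical symplectic form *)

Section LocalForms.
Variables (R : realType) (m : nat) (M : Type) (A : atlas R m M).
Hypothesis hA : diff_atlas A.

Lemma pullback1_chart_inv c x (b : form1 A) : charts A c -> chart_dom c x ->
  pullback1 (model_atlas R m) A (chart_inv c) b (chart_coord c x) =
  (b x : 'rV[R]_m) *m (transition_mx c (chart_at A x) x)^T.
Proof.
move=> Ac cx; rewrite /pullback1.
apply: (etrans (cotangent_map_mulmx _ _)).
  by move=> v; exact: tangent_map_chart_inv.
by rewrite (diff_atlas_coordK hA Ac cx).
Qed.

(** The values of [b] at nearby points [y] are stored in their own preferred frames; the hypothesis
    converts them all to the chart at [x], the one in which the derivative is taken. *)
Lemma ext_derivative_local (b : form1 A) (g : 'rV[R]_m -> 'rV[R]_m) x u v :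
  (forall y, chart_dom (chart_at A x) y ->
    (b y : 'rV[R]_m) *m (transition_mx (chart_at A x) (chart_at A y) y)^T =
    g (chart_coord (chart_at A x) y)) ->
  ext_derivative b x u v =
  'D_u (fun z => pairing (g z) v) (chart_coord (chart_at A x) x) -
  'D_v (fun z => pairing (g z) u) (chart_coord (chart_at A x) x).
Proof.
move=> bg; have [Ac cx] := diff_atlas_at hA x.
by rewrite /ext_derivative; congr (_ - _); apply: near_eq_derive;
  apply: filterS (near_chart hA Ac Ac cx cx) => _ [y [<- _ cy _]];
  rewrite pullback1_chart_inv// bg.
Qed.

Lemma diff_gradient (f : 'rV[R]_m -> R) z v :
  'd f z v = (gradient f z *m v^T) 0 0.
Proof.
rewrite {1}(row_sum_delta v) linear_sum -pairingE; apply: eq_bigr => i _.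
by rewrite linearZ mxE mulrC.
Qed.

Lemma gradient_transition (f : M -> R) c d x : charts A c -> charts A d ->
  chart_dom c x -> chart_dom d x ->
  differentiable (f \o chart_inv d) (chart_coord d x) ->
  gradient (f \o chart_inv c) (chart_coord c x) =
  gradient (f \o chart_inv d) (chart_coord d x) *m (transition_mx c d x)^T.
Proof.
move=> Ac Ad cx dx fD; apply/rowP => j; rewrite mxE (local_diff hA _ Ac Ad)//.
by rewrite diff_gradient trmx_mul mulmxA /unit_row trmx_delta -colE mxE.
Qed.

End LocalForms.

(** * Musical maps and traces of powers in matrix form *)

Lemma flat_mulmx (R : realType) (m : nat) (M : Type) (A : atlas R m M)
    (w : form2 A) x (B : 'M[R]_m) (u : 'rV[R]_m) :
  (forall u v, w x u v = (u *m B *m v^T) 0 0) -> flat w x u = u *m B.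
Proof.
move=> wB; apply/rowP => j.
by rewrite mxE wB /unit_row trmx_delta -colE mxE.
Qed.

(** Invertibility of [B] makes the vector sought by [xget] exist and be unique, so the default value
    0 is not what is returned. *)
Lemma sharp_mulmx (R : realType) (m : nat) (M : Type) (A : atlas R m M)
    (w : form2 A) x (B : 'M[R]_m) (a : 'rV[R]_m) : B \in unitmx ->
  (forall u v, w x u v = (u *m B *m v^T) 0 0) -> sharp w x a = a *m invmx B.
Proof.
move=> Bunit wB; rewrite /sharp; apply: xget_unique => [|u /=].
  by rewrite /mkset (flat_mulmx _ wB) mulmxKV.
by rewrite (flat_mulmx _ wB) => <-; rewrite mulmxK.
Qed.

Lemma iter_mulmxr (R : realType) (m : nat) (f : 'rV[R]_m -> 'rV[R]_m)
    (B : 'M[R]_m) l (a : 'rV[R]_m) : (forall a, f a = a *m B) ->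
  iter l f a = a *m iter l (mulmx B) 1%:M.
Proof.
move=> fB; elim: l a => [|l IHl] a; first by rewrite mulmx1.
by rewrite iterSr IHl fB -mulmxA.
Qed.

Lemma iter_mulmx_similar (R : realType) (m : nat) (S B C : 'M[R]_m) l :
  S *m B = C *m S ->
  S *m iter l (mulmx B) 1%:M = iter l (mulmx C) 1%:M *m S.
Proof.
move=> SB; elim: l => [|l IHl] /=; first by rewrite mulmx1 mul1mx.
by rewrite mulmxA SB -!mulmxA IHl.
Qed.

(** The intertwining relation passes to powers, and cyclicity of the trace removes [S]. It serves to
    compare traces read in two charts. *)
Lemma mxtrace_iter_similar (R : realType) (m : nat) (S B C : 'M[R]_m) l :
  S \in unitmx -> S *m B = C *m S ->
  \tr (iter l (mulmx B) 1%:M) = \tr (iter l (mulmx C) 1%:M).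
Proof.
move=> Sunit /(iter_mulmx_similar l).
move: (iter _ _ _) (iter _ _ _) => Y X SX.
by rewrite -(mulKmx Sunit X) SX mxtrace_mulC mulmxK.
Qed.

(** * The tautological and symplectic forms in cotangent charts *)

Section CanonicalForm.
Variables (R : realType) (n : nat) (Q : topologicalType) (A : atlas R n Q).
Hypothesis hQ : smooth_manifold A.

Let hA := smooth_manifold_diff_atlas hQ.
Local Notation TQ := (cotangent_bundle A).
Local Notation B := (cotangent_atlas A).
Local Notation cc := (cotangent_chart A).
Local Notation P := (fst_mx R n).
Local Notation N := (snd_mx R n).
Local Notation J := (canonical_mx R n).

Lemma cotangent_diff_atlas : diff_atlas B.
Proof.
split.
- move=> x; have [Aq qq] := diff_atlas_at hA (bundle_proj x).
  by split=> //; exists (chart_at A (bundle_proj x)).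
- by move=> _ [c Ac <-] x cx; exact: cotangent_chart_coordK.
- by move=> _ _ [c Ac <-] [d Ad <-]; exact: cotangent_overlap_open.
- move=> _ _ [c Ac <-] [d Ad <-] x cx dx.
  apply: (cotangent_transition_differentiable hQ Ac Ad cx dx).
  by rewrite row_mxKl.
Qed.

Let hB := cotangent_diff_atlas.

Lemma transition_symplectic c d x : charts B c -> charts B d ->
  chart_dom c x -> chart_dom d x ->
  transition_mx c d x *m J *m (transition_mx c d x)^T = J.
Proof.
move=> [c' Ac <-] [d' Ad <-] cx dx.
by apply: (jacobian_transition_symplectic hQ Ac Ad cx dx); rewrite row_mxKl.
Qed.

(** The preferred chart at [x] is induced by the one at its base point, so in these charts the
    projection reads as [lsubmx]. *)
Lemma tautological_form_mx (x : TQ) :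
  tautological_form A x = (projT2 x : 'rV[R]_n) *m P^T.
Proof.
apply: cotangent_map_mulmx => v.
have [Aq qq] := diff_atlas_at hA (bundle_proj x).
rewrite -(jacobian_lsubmx (chart_coord (chart_at B x) x)) mul_jacobian.
have lD : differentiable lsubmx (chart_coord (chart_at B x) x).
  exact: differentiable_lsubmx.
move: v; apply/funeqP/esym; apply: near_eq_diff lD.
have xq : lsubmx (chart_coord (chart_at B x) x) =
    chart_coord (chart_at A (bundle_proj x)) (bundle_proj x).
  by rewrite row_mxKl.
apply: filterS (near_cotangent_overlap hQ Aq Aq qq qq xq) => z [q [cq _ zq]].
by rewrite /= /bundle_proj /= zq (diff_atlas_coordK hA Aq cq).
Qed.

(** Preferred charts may vary with the point, but by [transition_tautological] the form has
    components [z *m N *m P^T] throughout the chart at [x]. These are linear in [z], and their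
    antisymmetrised derivative is [J] up to the sign in the definition. *)
Lemma canonical_form_mx (x : TQ) (u v : 'rV[R]_(n + n)) :
  canonical_symplectic_form A x u v = (u *m J *m v^T) 0 0.
Proof.
have [[c Ac cE] _] := diff_atlas_at hB x.
rewrite /canonical_symplectic_form.
rewrite (@ext_derivative_local _ _ _ _ hB _ (fun z => z *m N *m P^T));
  last first.
  move=> y; rewrite -cE => cy.
  have [Ad dy] := diff_atlas_at hA (bundle_proj y).
  have yq : lsubmx (chart_coord (cc c) y) = chart_coord c (bundle_proj y).
    by rewrite row_mxKl.
  have fibre : (chart_coord (cc (chart_at A (bundle_proj y))) \o chart_inv (cc c))
      (chart_coord (cc c) y) *m N = projT2 y.
    apply: (etrans (congr1 (mulmx^~ N) (chart_transition hB _
      (ex_intro2 _ _ c Ac erefl) cy))).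
    rewrite mul_snd_mx (cotangent_chart_coordE hQ Ad dy) row_mxKr.
    by rewrite (transition_mx_id hA Ad dy) trmx1 mulmx1.
  apply: (etrans _ (transition_tautological hQ Ac Ad cy dy yq)).
  rewrite tautological_form_mx trmx_mul mulmxA.
  exact: (congr1 (fun a => a *m P^T *m _) (esym fibre)).
have pairD (w w' z : 'rV[R]_(n + n)) :
    'D_w (fun z => pairing (z *m N *m P^T) w') z = (w *m N *m P^T *m w'^T) 0 0.
  have [fD fE] := mx_is_diff_mulr w'^T (mx_is_diff_mulr P^T
    (mx_is_diff_mulr N (mx_is_diff_id z))) 0 0.
  rewrite (_ : (fun y => _) = fun y => (y *m N *m P^T *m w'^T) 0 0); last first.
    by apply/funext => y; rewrite pairingE.
  by apply: (etrans (deriveE _ fD)); rewrite fE.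
have swap : (v *m N *m P^T *m u^T) 0 0 = (u *m P *m N^T *m v^T) 0 0.
  by rewrite -scalar_mx_tr !trmx_mul !trmxK !mulmxA.
rewrite !pairD swap opprB mulmxBr mulmxBl !mulmxA [RHS]mxE.
by rewrite [X in _ = _ + X]mxE.
Qed.

End CanonicalForm.

(** * Fouling maps *)

Section Fouling.
Variables (R : realType) (n : nat) (Q : topologicalType) (A : atlas R n Q).
Hypothesis hQ : smooth_manifold A.
Variables (H : cotangent_bundle A -> R).
Variable Psi : cotangent_bundle A -> cotangent_bundle A.
Hypotheses (hH : smooth_fun (cotangent_atlas A) H) (hPsi : fouling_map H Psi).

Let hB := cotangent_diff_atlas hQ.
Local Notation B := (cotangent_atlas A).
Local Notation J := (canonical_mx R n).
Local Notation K := (invmx (canonical_mx R n)).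
Local Notation chart_at_ y := (chart_at B y).
Local Notation Psi_ c := (chart_coord c \o Psi \o chart_inv c).

(** One chart serves at both source and target: [Psi] covers the identity and chart domains are
    unions of fibres. As [J] represents the canonical form in every cotangent chart, this is the
    matrix of [omega_Psi] in [c]. *)
Definition pulled_mx (c : chart R (n + n) (cotangent_bundle A))
    (z : 'rV[R]_(n + n)) : 'M[R]_(n + n) :=
  jacobian (Psi_ c) z *m J *m (jacobian (Psi_ c) z)^T.

Lemma fouling_dom c y : charts B c -> chart_dom c y -> chart_dom c (Psi y).
Proof. by move=> [c' _ <-] /=; rewrite hPsi.1.2. Qed.

Lemma fouling_smooth c : charts B c ->
  open (chart_coord c @` chart_dom c) /\
  smooth_on (chart_coord c @` chart_dom c) (Psi_ c).
Proof.
move=> Bc; have := hPsi.1.1 c c Bc Bc.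
suff -> : chart_dom c `&` Psi @^-1` chart_dom c = chart_dom c by [].
by apply/seteqP; split=> [y []|y cy]//; split=> //; exact: fouling_dom.
Qed.

Lemma omega_Psi_mx y (u v : 'rV[R]_(n + n)) :
  @omega_Psi R n Q A Psi y u v =
  (u *m pulled_mx (chart_at_ y) (chart_coord (chart_at_ y) y) *m v^T) 0 0.
Proof.
rewrite /omega_Psi /pullback2 (canonical_form_mx hQ) /pulled_mx.
(* The preferred chart depends only on the base point, hence is the same at [Psi y] as at [y]. *)
have tangentE w : tangent_map B B Psi y w =
    w *m jacobian (Psi_ (chart_at_ y)) (chart_coord (chart_at_ y) y).
  by rewrite mul_jacobian /tangent_map /= hPsi.1.2.
by rewrite !tangentE trmx_mul !mulmxA.
Qed.

(** Changing charts multiplies the Jacobian of [Psi] by transition matrices at [y] and at [Psi y];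
    the latter is symplectic and is absorbed by [J]. *)
Lemma pulled_mx_transition c d y : charts B c -> charts B d ->
  chart_dom c y -> chart_dom d y ->
  pulled_mx c (chart_coord c y) =
  transition_mx c d y *m pulled_mx d (chart_coord d y) *m (transition_mx c d y)^T.
Proof.
move=> Bc Bd cy dy.
have [oc sc] := fouling_smooth Bc; have [od sd] := fouling_smooth Bd.
have cPsi := fouling_dom Bc cy; have dPsi := fouling_dom Bd dy.
have near_dom : \forall z \near chart_coord c y, chart_dom c (Psi (chart_inv c z)).
  apply: filterS (near_chart hB Bc Bc cy cy) => _ [x [_ -> cx _]].
  exact: fouling_dom.
have cD : differentiable (Psi_ c) (chart_coord c y).
  by apply: (sc [::]); exists y.
have dD : differentiable (Psi_ d) (chart_coord d y).
  by apply: (sd [::]); exists y.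
have E := local_jacobian hB Bc Bd cy dy cPsi dPsi near_dom cD dD.
have congr_mx (D D' t t' : 'M[R]_(n + n)) : D *m t' = t *m D' ->
    t' *m J *m t'^T = J -> D *m J *m D^T = t *m (D' *m J *m D'^T) *m t^T.
  move=> Dt tJ; rewrite -{1}tJ !mulmxA Dt -(mulmxA _ t'^T) -trmx_mul Dt.
  by rewrite trmx_mul !mulmxA.
exact: congr_mx E (transition_symplectic hQ Bc Bd cPsi dPsi).
Qed.

(** This is symplecticity for the Poisson bivector: [t *m J *m t^T = J] gives [J *m t^T] as the
    inverse of [t] times [J]. *)
Lemma transition_inverse c d y : charts B c -> charts B d ->
  chart_dom c y -> chart_dom d y ->
  (transition_mx c d y)^T *m K *m transition_mx c d y = K.
Proof.
move=> Bc Bd cy dy; set t := transition_mx c d y.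
have Junit := canonical_mx_unit R n.
have tJ : t *m J *m t^T = J := transition_symplectic hQ Bc Bd cy dy.
have st := transition_mxV hB Bd Bc dy cy.
have : J *m t^T = transition_mx d c y *m J.
  by rewrite -[in RHS]tJ !mulmxA st mul1mx.
move/(congr1 (mulmx K)); rewrite mulKmx// => ->.
by rewrite -!mulmxA (mulmxA J) mulmxV// mul1mx st mulmx1.
Qed.

Lemma hamiltonian_mx y :
  hamiltonian_vector_field H y = (differential B H y : 'rV[R]_(n + n)) *m K.
Proof.
apply: sharp_mulmx; first exact: canonical_mx_unit.
by move=> u v; exact: canonical_form_mx.
Qed.

Lemma L_Psi_trace y l : cotangent_trace (iter l (L_Psi Psi y)) =
  \tr (iter l (mulmx (K *m pulled_mx (chart_at_ y) (chart_coord (chart_at_ y) y)))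
    1%:M).
Proof.
have LE (a : 'rV[R]_(n + n)) : (L_Psi Psi y : 'rV[R]_(n + n) -> _) a =
    a *m (K *m pulled_mx (chart_at_ y) (chart_coord (chart_at_ y) y)).
  rewrite /L_Psi (flat_mulmx _ (@omega_Psi_mx y)).
  rewrite (@sharp_mulmx _ _ _ _ _ _ J) ?mulmxA ?canonical_mx_unit//.
  by move=> u v; exact: canonical_form_mx.
congr (\tr _); apply/matrixP => i j.
by rewrite [LHS]mxE (iter_mulmxr l _ LE) -rowE mxE.
Qed.

(** The trace at [y] is defined in the preferred chart of [y], while differentiation needs one fixed
    chart. The two matrices of [L_Psi] are conjugate by [t^T]. *)
Lemma L_Psi_trace_local c y l : charts B c -> chart_dom c y ->
  cotangent_trace (iter l (L_Psi Psi y)) =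
  \tr (iter l (mulmx (K *m pulled_mx c (chart_coord c y))) 1%:M).
Proof.
move=> Bc cy; rewrite L_Psi_trace.
have [Bd dy] := diff_atlas_at hB y.
set t := transition_mx c (chart_at_ y) y.
have [tunit _] := mulmx1_unit (transition_mxV hB Bc Bd cy dy).
apply/esym/(@mxtrace_iter_similar _ _ t^T); first by rewrite unitmx_tr.
rewrite (pulled_mx_transition Bc Bd cy dy) !mulmxA.
by rewrite (transition_inverse Bc Bd cy dy).
Qed.

Lemma gradient_local c y : charts B c -> chart_dom c y ->
  gradient (H \o chart_inv c) (chart_coord c y) =
  (differential B H y : 'rV[R]_(n + n)) *m
    (transition_mx c (chart_at_ y) y)^T.
Proof.
move=> Bc cy; have [Bd dy] := diff_atlas_at hB y.
apply: (gradient_transition hB Bc Bd cy dy).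
by apply: (hH Bd [::]); exists y.
Qed.

Lemma interior_product_local c y : charts B c -> chart_dom c y ->
  (interior_product (hamiltonian_vector_field H) (omega_Psi Psi) y
     : 'rV[R]_(n + n)) *m (transition_mx c (chart_at_ y) y)^T =
  gradient (H \o chart_inv c) (chart_coord c y) *m K *m
    pulled_mx c (chart_coord c y).
Proof.
move=> Bc cy; have [Bd dy] := diff_atlas_at hB y.
rewrite /interior_product (flat_mulmx _ (@omega_Psi_mx y)) hamiltonian_mx.
rewrite (gradient_local Bc cy) (pulled_mx_transition Bc Bd cy dy).
have cancel (a : 'rV[R]_(n + n)) (t W : 'M[R]_(n + n)) : t^T *m K *m t = K ->
    a *m K *m W *m t^T = a *m t^T *m K *m (t *m W *m t^T).
  by move=> tK; rewrite -{1}tK !mulmxA.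
exact: cancel (transition_inverse Bc Bd cy dy).
Qed.

Lemma lie_derivative_trace l x :
  lie_derivative_fun (hamiltonian_vector_field H)
    (fun y => cotangent_trace (iter l (L_Psi Psi y))) x = 0.
Proof.
have [Bc cx] := diff_atlas_at hB x; set c := chart_at_ x in Bc cx.
have [oc Psi_c_smooth] := fouling_smooth Bc.
have Uz : (chart_coord c @` chart_dom c) (chart_coord c x) by exists x.
have closed u v :
    'D_u (fun z => pairing (gradient (H \o chart_inv c) z *m K *m pulled_mx c z) v)
      (chart_coord c x) -
    'D_v (fun z => pairing (gradient (H \o chart_inv c) z *m K *m pulled_mx c z) u)
      (chart_coord c x) = 0.
  (* The fouling condition at [x] is rewritten in the fixed chart [c], as [trace_power_invariant]
     requires. *)
  rewrite -(hPsi.2 x u v); apply: esym; apply: (ext_derivative_local hB) => y cy.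
  exact: interior_product_local Bc cy.
have [df dfD df0] := trace_power_invariant (canonical_mx_unit R n)
  (canonical_mx_anti R n) oc Psi_c_smooth (hH Bc) l Uz closed.
have fD : is_diff (chart_coord c x)
    ((fun y => cotangent_trace (iter l (L_Psi Psi y))) \o chart_inv c) df.
  apply: near_eq_is_diff dfD.
  apply: filterS (near_chart hB Bc Bc cx cx) => _ [y [<- /= cy dy _]].
  by rewrite cy (L_Psi_trace_local l Bc dy).
(* In the preferred chart [differential] is the coordinate gradient, so the Lie derivative is [df]
   evaluated at the coordinate row of the Hamiltonian field. *)
rewrite /lie_derivative_fun hamiltonian_mx pairingE -df0 -(diff_val (is_diff_def := fD)).
by rewrite diff_gradient.
Qed.

End Fouling.

Theorem theorem3p6 (R : realType) (n : nat) (Q : topologicalType)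
    (A : atlas R n Q) (hQ : smooth_manifold A)
    (H : cotangent_bundle A -> R) (hH : smooth_fun (cotangent_atlas A) H)
    (Psi : cotangent_bundle A -> cotangent_bundle A)
    (hPsi : fouling_map H Psi) (l : nat) (x : cotangent_bundle A) :
  lie_derivative_fun (hamiltonian_vector_field H)
    (fun y => cotangent_trace (iter l (L_Psi Psi y))) x = 0.
Proof. exact: lie_derivative_trace. Qed.
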